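(* Let $S$, $\Pi_1$, $U$, $\overline{U}$, $sw$, $V_T$, $\mathbf W$, $\mathcal P$, $I$, $J$ and $M(S)$ be as in the context, and suppose that $|\Pi_1|$ is even and $4\le|\Pi_1|\le n-3$. For $1\le i\le 4$ put $$B_i=\{j\in[n-1]~|~j\equiv i,\ i+|\Pi_1|-2,\ n-i, \text{ or } n-i+|\Pi_1|-2\pmod 4\},$$ $$C_i=\{j\in[n]~|~j\equiv i,\ i+|\Pi_1|,\ n+2-i, \text{ or } n+2-i+|\Pi_1|\pmod 4\}.$$ Then the nontrivial orbits of $F_2^n$ under $\mathbf W$ are $U_{B_1},U_{B_2},U_{B_3},U_{B_4},\overline U_{C_1},\overline U_{C_2},\overline U_{C_3},\overline U_{C_4}$ (some of these may coincide). In particular the number of orbits (including the trivial one) is $$|\mathcal P|=\begin{cases}6, & \text{if } n \text{ is even};\\ 4, & \text{if } n \text{ is odd},\end{cases}$$ and $$M(S)=\begin{cases}1, & \text{if } B_i\cap I\ne\emptyset \text{ and } C_i\cap J\neq\emptyset \text{ for all } i;\\ 2, & \text{otherwise.}\end{cases}$$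
   Context: $S$ is a finite simple connected graph with vertex set $\{s_1,\dots,s_n\}$, $n\ge2$, and edge set $R$, such that $s_1,\dots,s_{n-1}$ is an induced path. The neighbours of $s_n$ are $s_{j_1},\dots,s_{j_m}$ with $1\le j_1<\dots<j_m\le n-1$. $\widetilde s$ is the characteristic vector in $F_2^n$ (coordinates indexed by vertices) of vertex $s$. The flipping move of $s$ is $\mathbf s\in\mathrm{Mat}_n(F_2)$ with $\mathbf s_{ab}=1$ if $a=b$, or if $b=s$ and $ab\in R$, and $0$ otherwise. $\mathbf W=\langle\mathbf{s_1},\dots,\mathbf{s_n}\rangle\le\mathrm{GL}_n(F_2)$ acts on $F_2^n$ by left multiplication. $\mathcal P$ is its set of orbits (the equivalence classes of the lit-only flipping puzzle); $\{0\}$ is the trivial orbit. $\overline1=\widetilde s_1$ and $\overline{i+1}=\mathbf{s_i}\cdots\mathbf{s_1}\overline1$ for $1\le i\le n-1$. Also $\overline{n+1}:=\widetilde s_n$. $\Pi=\{\overline1,\dots,\overline n\}$, $\Pi_0=\{\overline i\in\Pi:\langle\overline i,\widetilde s_n\rangle=0\}$, $\Pi_1=\Pi\setminus\Pi_0$, and $[\overline i]=\{\overline1,\dots,\overline i\}$. $U=\mathrm{span}(\Pi)$ and $\overline U=F_2^n\setminus U$. When $|\Pi_1|$ is even, $\Delta=(\Pi\cup\{\overline{n+1}\})\setminus\{\overline n\}$, which is a basis of $F_2^n$. $\Delta(u)$ is the subset of $\Delta$ summing to $u$, $sw(u)=|\Delta(u)|$, and $V_T=\{u\in V:sw(u)\in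 T\}$. $[k]=\{1,\dots,k\}$. $w$ is Hamming weight, $w(O)=\min_{u\in O}w(u)$, and $M(S)=\max_{O\in\mathcal P}w(O)$. When $|\Pi_1|$ is even, $I=\{i\in[n-1]: |[\overline i]\cap\Pi_1| \text{ is even}\}$ and $J=\{i\in[n]: |[\overline{i-1}]\cap\Pi_1| \text{ is odd, or } i=1\}$. *)

(* Defs.v *)
From mathcomp Require Import all_boot all_order all_algebra all_fingroup.
Set Implicit Arguments.
Unset Strict Implicit.
Unset Printing Implicit Defensive.
Import GRing.Theory.

(* The graph has n = p.+1 vertices, so that 'M['F_2]_n has a unit group
   {'GL_n['F_2]} without casts. Vertices, vectors and indices are numbered
   from 1 as in the mathematics: vtx i is s_i (1 <= i <= n), that is, the
   ordinal of value i.-1. Edges are given by a relation e on 'I_n. *)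

Section FlippingPuzzle.

Variables (p : nat) (e : rel 'I_p.+1).
Local Notation n := p.+1.
Local Notation vec := 'cV['F_2]_n.

Definition vtx (i : nat) : 'I_n := inord i.-1.

Definition induced_path : Prop :=
  forall i j, 1 <= i <= n.-1 -> 1 <= j <= n.-1 ->
    e (vtx i) (vtx j) = (j == i.+1) || (i == j.+1).

Definition charvec (s : 'I_n) : vec := delta_mx s 0%R.

Definition dot (u v : vec) : 'F_2 := (u^T *m v)%R 0%R 0%R.

Definition flip (s : 'I_n) : 'M['F_2]_n :=
  (\matrix_(a, b) ((a == b) || ((b == s) && e a b))%:R)%R.

(* Hence no generator is lost in flip_group below. *)
Lemma flip_unitmx (s : 'I_n) : irreflexive e -> flip s \in unitmx.
Proof.
move=> irr_e; suff flipK : (flip s *m flip s = 1%:M)%R.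
  by case: (mulmx1_unit flipK).
pose N : 'M['F_2]_n := (\matrix_(a, b) ((b == s) && e a b)%:R)%R.
have flipE : (flip s = 1%:M + N)%R.
  apply/matrixP=> a b; rewrite !mxE; have [->|_] := eqVneq a b.
    by rewrite irr_e andbF addr0.
  by rewrite add0r.
have NN0 : (N *m N = 0)%R.
  apply/matrixP=> a b; rewrite !mxE big1 // => c _; rewrite !mxE.
  have [->|_] := eqVneq c s; last by rewrite mul0r.
  by have [->|_] := eqVneq b s; rewrite ?irr_e mulr0.
have NN : (N + N = 0)%R.
  by apply/matrixP=> a b; rewrite !mxE; case: (_ && _); apply/eqP.
by rewrite flipE mulmxDl !mulmxDr NN0 !mulmx1 !mul1mx addr0 -addrA NN addr0.
Qed.

Definition flip_group : {group {'GL_n['F_2]}} :=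
  <<[set g : {'GL_n['F_2]} | [exists s, GLval g == flip s]]>>%G.

Definition flip_orbit (u : vec) : {set vec} :=
  [set (GLval g *m u)%R | g : {'GL_n['F_2]} in flip_group].

Definition flip_orbits : {set {set vec}} := [set flip_orbit u | u : vec].

(* bar i.+1 = s_i ... s_1 (bar 1) for 1 <= i <= n - 1; bar 0 is not used, and
   the vector written with index n + 1 is charvec (vtx n). *)
Fixpoint bar (i : nat) : vec :=
  match i with
  | 0 => 0%R
  | j.+1 => if j == 0 then charvec (vtx 1) else (flip (vtx j) *m bar j)%R
  end.

Definition bars (i : nat) : {set vec} := [set:: [seq bar k | k <- iota 1 i]].

Definition Pi : {set vec} := bars n.
Definition Pi0 : {set vec} := [set v in Pi | dot v (charvec (vtx n)) == 0%R].
Definition Pi1 : {set vec} := Pi :\: Pi0.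

Definition U : {set vec} := [set u | u \in <<enum Pi>>%VS].
Definition Ubar : {set vec} := ~: U.

Definition Delta : {set vec} := (charvec (vtx n) |: Pi) :\ bar n.

(* Delta is a basis when #|Pi1| is even; then A below exists and is unique. *)
Definition Delta_supp (u : vec) : {set vec} :=
  odflt set0 [pick A : {set vec} | (A \subset Delta) && (\sum_(v in A) v == u)%R].

Definition sw (u : vec) : nat := #|Delta_supp u|.

Definition sw_part (V : {set vec}) (T : pred nat) : {set vec} :=
  [set u in V | T (sw u)].

Definition weight (u : vec) : nat := #|[set i | u i 0%R != 0%R]|.

(* Weights are at most n, so n is neutral for this minimum. *)
Definition min_weight (O : {set vec}) : nat := \big[minn/n]_(u in O) weight u.

Definition max_min_weight : nat := \max_(O in flip_orbits) min_weight O.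

Definition Iset : pred nat :=
  [pred i | (1 <= i <= n.-1) && ~~ odd #|bars i :&: Pi1|].

Definition Jset : pred nat :=
  [pred i | (1 <= i <= n) && (odd #|bars i.-1 :&: Pi1| || (i == 1))].

(* The subtractions are those of nat; none of them truncates when
   1 <= i <= 4 <= #|Pi1| <= n. *)
Definition Bset (i : nat) : pred nat :=
  [pred j | (1 <= j <= n.-1) &&
     [|| j == i %[mod 4], j == i + #|Pi1| - 2 %[mod 4],
         j == n - i %[mod 4] | j == n - i + #|Pi1| - 2 %[mod 4]]].

Definition Cset (i : nat) : pred nat :=
  [pred j | (1 <= j <= n) &&
     [|| j == i %[mod 4], j == i + #|Pi1| %[mod 4],
         j == n + 2 - i %[mod 4] | j == n + 2 - i + #|Pi1| %[mod 4]]].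

End FlippingPuzzle.

(* Main.v *)
Require Import Defs.
From mathcomp Require Import all_boot all_order all_algebra all_fingroup.
From mathcomp Require Import zify.
Set Implicit Arguments.
Unset Strict Implicit.
Unset Printing Implicit Defensive.
Import GRing.Theory.

(* The move of a path vertex s_i exchanges bar i and bar (i+1), fixes the other
   bars and s_n. As #|Pi1| is even, the bars sum to 0, and the move of s_n adds
   the sum of Pi1 to the vectors having coordinate 1 at s_n. Hence, if u is the
   sum of a set A of bars, plus d s_n with d = 0 or 1, its orbit is determined
   by d and k = #|A|, where k may be replaced with n - k (complement of A) and,
   through the move of s_n, with k + #|Pi1| - 2t whenever t = #|A :&: Pi1| can
   be chosen with t + d odd. Two such replacements turn k into k + 4, so that
   only residues mod 4 matter, while the other ones account for the remaining
   identifications. Finally, s_k is the sum of bar 1, ..., bar k, up to s_n, so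
   for some k, s_k or s_k + s_n (or s_n alone) lies in a given nonzero orbit,
   and B_i, C_i meet I, J exactly when a single s_k or s_n does. *)

(** * Finite sets and classes of residues mod 4 *)

Definition symdiff (T : finType) (A B : {set T}) : {set T} :=
  [set x | (x \in A) (+) (x \in B)].

Lemma card_symdiff (T : finType) (A B : {set T}) :
  #|symdiff A B| + 2 * #|A :&: B| = #|A| + #|B|.
Proof.
have -> : symdiff A B = (A :|: B) :\: (A :&: B).
  by apply/setP => x; rewrite !inE; case: (x \in A); case: (x \in B).
have := cardsUI A B.
have := cardsID (A :&: B) (A :|: B).
have -> : (A :|: B) :&: (A :&: B) = A :&: B.
  by apply/setP => x; rewrite !inE; case: (x \in A); case: (x \in B).
lia.
Qed.

Lemma exists_subset_card (T : finType) (B : {set T}) k : k <= #|B| ->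
  exists2 A : {set T}, A \subset B & #|A| = k.
Proof.
case/card_geqP => s [s_uniq s_size sB]; exists [set:: s].
  by apply/subsetP => x; rewrite inE => /sB.
by rewrite cardsE (card_uniqP s_uniq).
Qed.

(* With this t, the moves k -> k + q - 2 * t and then -> k + 4 are both
   possible. *)
Lemma exists_split (n q k : nat) (d : bool) :
    ~~ odd q -> 4 <= q -> q + 3 <= n ->
    ~~ d <= k <= n - ~~ d -> ~~ d <= k + 4 <= n - ~~ d ->
  exists t, [/\ t <= k, t + 2 <= q, k - t + 2 + q <= n & odd (t + d)].
Proof.
move=> q_even q_ge4 q_le k1 k2.
(* The third bound says that t is at least k + q + 2 - n (truncated at 0); this lower bound is
   taken, or its successor if the parity is wrong. *)
exists (if odd (k + q + 2 - n + d) then k + q + 2 - n else (k + q + 2 - n).+1).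
by case: d k1 k2 => /= k1 k2; case: ifP => ?; split; lia.
Qed.

(* Here k and i are numbers of bars, whereas the paper's C_i (case d = true)
   counts s_n as well: its indices are shifted by one. The shift q - 2 of B_i
   is written q + 2 to avoid truncated subtraction. *)
Definition same_class (n q : nat) (d : bool) (k i : nat) :=
  [|| k == i %[mod 4], k == i + q + 2 + 2 * d %[mod 4],
      k + i == n %[mod 4] | k + i == n + q + 2 + 2 * d %[mod 4]].

Lemma same_class_mod n q d k i :
  same_class (n %% 4) (q %% 4) d (k %% 4) (i %% 4) = same_class n q d k i.
Proof. by rewrite /same_class; congr [|| _, _, _ | _]; lia. Qed.

(* The class of x.2, encoded by its residues mod 4, so that counting classes is
   a computation for each value of n and q mod 4. *)
Definition class_key (n q : nat) (x : bool * nat) : bool * seq bool :=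
  (x.1, [seq same_class n q x.1 x.2 j | j <- iota 0 4]).

Lemma class_key_mod n q d i :
  class_key n q (d, i) = class_key (n %% 4) (q %% 4) (d, i %% 4).
Proof.
congr pair; apply: eq_map => j.
by rewrite -[LHS]same_class_mod -[RHS]same_class_mod !modn_mod.
Qed.

Lemma even_mod4 q : ~~ odd q -> q %% 4 \in [:: 0; 2].
Proof. by rewrite !inE; lia. Qed.

Lemma mem_iota4 m : m %% 4 \in iota 0 4.
Proof. by rewrite mem_iota ltn_mod. Qed.

(** For q even, [same_class] is an equivalence relation, so equal keys amount to related indices.
    Everything depends on residues mod 4 only, which leaves a finite check. *)
Lemma eq_class_key n q d i j : ~~ odd q ->
  (class_key n q (d, i) == class_key n q (d, j)) = same_class n q d i j.
Proof.
move=> q_even; rewrite !(class_key_mod n q) -same_class_mod.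
have check : all (fun N => all (fun q' => all (fun I => all (fun J =>
    (class_key N q' (d, I) == class_key N q' (d, J)) == same_class N q' d I J)
  (iota 0 4)) (iota 0 4)) [:: 0; 2]) (iota 0 4).
  by case: (d); vm_compute.
have := allP check _ (mem_iota4 n).
move=> /allP/(_ _ (even_mod4 q_even))/allP/(_ _ (mem_iota4 i)).
by move=> /allP/(_ _ (mem_iota4 j))/eqP.
Qed.

(** Without s_n the numbers start from 1, because no bars at all would give the zero vector. *)
Definition class_reps : seq (bool * nat) :=
  [seq (false, i) | i <- iota 1 4] ++ [seq (true, i) | i <- iota 0 4].

(** The shift q + 2 + 2d is 0 mod 4 for one value of d and 2 for the other. The former gives 2
    classes for n odd and 3 for n even, the latter 1 and 2. *)
Lemma count_classes n q : ~~ odd q ->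
  size (undup [seq class_key n q x | x <- class_reps]) = if odd n then 3 else 5.
Proof.
move=> q_even.
have -> : [seq class_key n q x | x <- class_reps] =
    [seq class_key (n %% 4) (q %% 4) (x.1, x.2 %% 4) | x <- class_reps].
  by apply: eq_map => -[d i]; exact: class_key_mod.
have -> : odd n = odd (n %% 4) by lia.
have check : all (fun N => all (fun q' =>
    size (undup [seq class_key N q' (x.1, x.2 %% 4) | x <- class_reps])
      == if odd N then 3 else 5) [:: 0; 2]) (iota 0 4).
  by vm_compute.
by have /allP/(_ _ (even_mod4 q_even))/eqP := allP check _ (mem_iota4 n).
Qed.

(** Transfers the count of the computable keys to the orbits. *)
Lemma size_undup_map (T T1 T2 : eqType) (f : T -> T1) (g : T -> T2) s :
    {in s &, forall x y, (f x == f y) = (g x == g y)} ->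
  size (undup (map f s)) = size (undup (map g s)).
Proof.
elim: s => //= x s IH fg.
have -> : (f x \in map f s) = (g x \in map g s).
  apply/mapP/mapP => -[y ys /eqP fgxy]; exists y => //; apply/eqP.
    by rewrite -fg // inE ?eqxx ?ys ?orbT.
  by rewrite fg // inE ?eqxx ?ys ?orbT.
have IHs : size (undup (map f s)) = size (undup (map g s)).
  by apply: IH => y z ys zs; apply: fg; rewrite inE ?ys ?zs orbT.
by case: ifP => _ /=; rewrite IHs.
Qed.

Lemma card_set_seq (T : finType) (s : seq T) : #|[set:: s]| = size (undup s).
Proof.
rewrite -(card_uniqP (undup_uniq s)) cardsE; apply: eq_card => x.
by rewrite mem_undup.
Qed.

(** * Elements of F_2 as booleans *)

Section BinaryField.

Local Open Scope ring_scope.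

Lemma F2_boolE (x : 'F_2) : x = (x != 0)%:R.
Proof. by case: x => [[|[|m]] m_lt] //; apply/val_inj. Qed.

Lemma F2_add_bool (a b : bool) : a%:R + b%:R = (a (+) b)%:R :> 'F_2.
Proof. by case: a b => [] [] //; apply/val_inj. Qed.

Lemma F2_bool_inj (a b : bool) : a%:R = b%:R :> 'F_2 -> a = b.
Proof. by case: a b => [] []. Qed.

Lemma F2_natr_odd m : m%:R = (odd m)%:R :> 'F_2.
Proof.
by elim: m => // m IH; rewrite -natr1 IH (F2_add_bool _ true) addbT.
Qed.

Lemma mxF2_addrr m k (M : 'M['F_2]_(m, k)) : M + M = 0.
Proof.
apply/matrixP => i j; rewrite !mxE [M i j]F2_boolE F2_add_bool.
by case: (_ != _).
Qed.

End BinaryField.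

(** * Moves and their orbits *)

Section LitOnly.

Local Open Scope ring_scope.

Variables (p : nat) (e : rel 'I_p.+1).
Hypothesis e_irr : irreflexive e.
Local Notation n := p.+1.
Local Notation vec := 'cV['F_2]_n.
Local Notation orb := (flip_orbit e).

Definition nbr (s : 'I_n) : vec := \col_a (e a s)%:R.

Lemma flip_mulE s (u : vec) : flip e s *m u = u + u s 0 *: nbr s.
Proof.
apply/matrixP => a j; rewrite (ord1 j) !mxE.
rewrite (bigD1 s) //= !mxE eqxx /=.
have [->|a_s] := eqVneq a s.
  rewrite e_irr /= mul1r mulr0 addr0 big1 ?addr0 // => i i_s.
  by rewrite !mxE (negPf i_s) eq_sym (negPf i_s) mul0r.
rewrite (bigD1 a) //= !mxE eqxx mul1r big1 => [|i /andP[i_s i_a]]; last first.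
  by rewrite !mxE (negPf i_s) eq_sym (negPf i_a) mul0r.
by rewrite addr0 addrC mulrC.
Qed.

Lemma orb_refl u : u \in orb u.
Proof. by apply/imsetP; exists 1%g; rewrite ?group1 //= mul1mx. Qed.

Lemma GL_mulE (g h : {'GL_n['F_2]}) : GLval (g * h)%g = GLval g *m GLval h.
Proof. by []. Qed.

Lemma flipK s : involutive (mulmx (flip e s) : vec -> vec).
Proof.
move=> u; rewrite !flip_mulE !mxE e_irr mulr0 addr0 -addrA.
by rewrite mxF2_addrr addr0.
Qed.

Lemma orb_flip_sub s u : orb (flip e s *m u) \subset orb u.
Proof.
pose g : {'GL_n['F_2]} := FinRing.Unit (flip_unitmx s e_irr).
have g_in : g \in flip_group e.
  by apply: mem_gen; rewrite inE; apply/existsP; exists s.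
apply/subsetP => _ /imsetP[h hG ->]; apply/imsetP.
by exists (h * g)%g; [exact: groupM | rewrite GL_mulE mulmxA].
Qed.

(** A move is an involution, so [orb_flip_sub] at the moved vector is the converse inclusion. *)
Lemma orb_flip s u : orb (flip e s *m u) = orb u.
Proof.
by apply/eqP; rewrite eqEsubset orb_flip_sub -{1}(flipK s u) orb_flip_sub.
Qed.

(* In a finite group, the elements mapping [V] into itself form a group. *)
Lemma orb_sub (V : {set vec}) u :
  (forall s v, v \in V -> flip e s *m v \in V) -> u \in V -> orb u \subset V.
Proof.
move=> V_flip uV.
pose H := [set g : {'GL_n['F_2]} | [forall (v | v \in V), GLval g *m v \in V]].
have H_group : group_set H.
  apply/group_setP; split=> [|g h].
    by rewrite inE; apply/forall_inP => v vV; rewrite mul1mx.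
  rewrite !inE => /forall_inP gV /forall_inP hV; apply/forall_inP => v vV.
  by rewrite GL_mulE -mulmxA gV ?hV.
have sGH : flip_group e \subset Group H_group.
  rewrite gen_subG; apply/subsetP => g; rewrite !inE => /existsP[s /eqP gs].
  by apply/forall_inP => v vV; rewrite gs V_flip.
apply/subsetP => _ /imsetP[g gG ->].
by have := subsetP sGH _ gG; rewrite inE => /forall_inP; apply.
Qed.

(** The form in which orbits are identified: stability under the moves gives one inclusion, equality
    of the orbits of the elements the other. *)
Lemma orb_part (V : {set vec}) u :
    (forall s v, v \in V -> flip e s *m v \in V) ->
    {in V &, forall v w, orb v = orb w} -> u \in V -> orb u = V.
Proof.
move=> V_flip V_eq uV; apply/eqP; rewrite eqEsubset orb_sub //=.
by apply/subsetP => v vV; rewrite -(V_eq v u) ?orb_refl.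
Qed.

(** * The bars along the path *)

Hypothesis e_sym : symmetric e.
Hypothesis e_path : induced_path e.
Local Notation last := (vtx p p.+1).

Definition barv (i : 'I_n) : vec := bar e i.+1.
Local Notation b := barv.

Lemma val_last : last = p :> nat.
Proof. by rewrite /vtx inordK. Qed.

Lemma vtx_succ (i : 'I_n) : vtx p i.+1 = i.
Proof. exact: inord_val. Qed.

Lemma edge_path (i j : 'I_n) : (i < p)%N -> (j < p)%N ->
  e i j = (j == i.+1 :> nat) || (i == j.+1 :> nat).
Proof.
move=> ip jp; have := e_path (i := i.+1) (j := j.+1) ip jp.
by rewrite !vtx_succ.
Qed.

Lemma bar_succ i :
  bar e i.+2 = bar e i.+1 + bar e i.+1 (vtx p i.+1) 0 *: nbr (vtx p i.+1).
Proof. by rewrite -flip_mulE. Qed.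

(** The move of s_(i+1) turns the lit pair s_i, s_(i+1) into s_(i+1), s_(i+2), as far as these lie
    on the path. The ordinal [k] stands for s_(k+1). *)
Lemma bar_coord i (k : 'I_n) : (i <= p)%N -> (k < p)%N ->
  bar e i.+1 k 0 = ((k == i :> nat) || (k.+1 == i))%:R.
Proof.
elim: i k => [|i IH] k ip kp.
  rewrite /= mxE eqxx andbT orbF; congr (_%:R); congr nat_of_bool.
  by rewrite -val_eqE /= inordK.
have iE : vtx p i.+1 = i :> nat by rewrite /vtx inordK // ltnW.
rewrite bar_succ !mxE !IH ?iE //; try lia.
rewrite eqxx mul1r edge_path ?iE // F2_add_bool.
by congr (_%:R); congr nat_of_bool; lia.
Qed.

Lemma barv_succ (i : 'I_n) : (i < p)%N -> b (inord i.+1) = b i + nbr i.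
Proof.
move=> ip; have sE : @inord p i.+1 = i.+1 :> nat by rewrite inordK.
rewrite /barv sE.
have bi : bar e i.+1 i 0 = 1 by rewrite bar_coord ?eqxx // ltnW.
by rewrite (bar_succ i) vtx_succ bi scale1r.
Qed.

Lemma nbr_path (i : 'I_n) : (i < p)%N -> nbr i = b i + b (inord i.+1).
Proof. by move=> ip; rewrite barv_succ // addrA mxF2_addrr add0r. Qed.

(** Only two bars are lit at a path vertex, and their sum is the vector of its neighbours, so the
    move exchanges them. *)
Lemma flip_path_bar (i j : 'I_n) : (i < p)%N ->
  flip e i *m b j = b (tperm i (inord i.+1) j).
Proof.
move=> ip; have sE : @inord p i.+1 = i.+1 :> nat by rewrite (@inordK p).
rewrite flip_mulE // bar_coord //; last by rewrite -ltnS.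
rewrite nbr_path //; case: tpermP => [-> | -> | /eqP ji /eqP js].
- by rewrite eqxx scale1r addrA mxF2_addrr add0r.
- by rewrite sE eqxx orbT scale1r addrC -addrA mxF2_addrr addr0.
have -> : (i == j :> nat) = false by rewrite eq_sym; apply/negbTE.
have -> : (i.+1 == j :> nat) = false.
  by rewrite -sE eq_sym; apply/negbTE.
by rewrite scale0r addr0.
Qed.

(** * Sums of bars and their coordinates *)

Definition Pi1_idx : {set 'I_n} := [set i | b i last 0 != 0].
Local Notation Q := Pi1_idx.

Lemma bar_last (i : 'I_n) : b i last 0 = (i \in Q)%:R.
Proof. by rewrite inE -F2_boolE. Qed.

(** By symmetry of [e], this is the coordinate at s_n of the neighbours of k, which [nbr_path]
    writes as a sum of two bars. *)
Lemma nbr_last_coord (k : 'I_n) : (k < p)%N ->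
  nbr last k 0 = (k \in Q)%:R + (inord k.+1 \in Q)%:R.
Proof.
move=> kp; rewrite -!bar_last.
have <- : nbr k last 0 = b k last 0 + b (inord k.+1) last 0.
  by rewrite nbr_path // [LHS]mxE.
by rewrite !mxE e_sym.
Qed.

(* As the index i of b is 0-based, [comb A d] is the sum of the bar (i + 1) for
   i in A, plus s_n if d. *)
Definition comb (A : {set 'I_n}) (d : bool) : vec :=
  \sum_(i in A) b i + charvec last *+ d.

Lemma sum_bar_coord (A : {set 'I_n}) (k : 'I_n) : (k < p)%N ->
  (\sum_(i in A) b i) k 0 = (k \in A)%:R + (inord k.+1 \in A)%:R.
Proof.
move=> kp; rewrite summxE.
have sE : @inord p k.+1 = k.+1 :> nat by rewrite (@inordK p).
rewrite (eq_bigr (fun i => (i == k)%:R + (i == inord k.+1)%:R)); last first.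
  move=> i _; rewrite bar_coord //; last by rewrite -ltnS.
  rewrite F2_add_bool -!val_eqE [val (inord _)]sE.
  by congr (_%:R); congr nat_of_bool => /=; lia.
have sum1 (j : 'I_n) : \sum_(i in A) (i == j)%:R = (j \in A)%:R :> 'F_2.
  have [jA|jA] := boolP (j \in A).
    by rewrite (bigD1 j) //= eqxx big1 ?addr0 // => i /andP[_ /negbTE->].
  by rewrite big1 // => i iA; case: eqP jA => // <-; rewrite iA.
by rewrite big_split /= !sum1.
Qed.

Lemma sum_bar_last (A : {set 'I_n}) :
  (\sum_(i in A) b i) last 0 = (odd #|A :&: Q|)%:R.
Proof.
rewrite summxE (eq_bigr _ (fun i _ => bar_last i)) -natr_sum -F2_natr_odd.
congr (_%:R); rewrite -sum1_card [in RHS]big_mkcond [in LHS]big_mkcond.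
by apply: eq_bigr => i _; rewrite !inE; case: (i \in A) => //; case: (_ != _).
Qed.

Lemma charvec_coord (s k : 'I_n) : charvec s k 0 = (k == s)%:R.
Proof. by rewrite mxE andbT. Qed.

Lemma neq_last (k : 'I_n) : (k < p)%N -> (k == last) = false.
Proof. by rewrite -val_eqE [val last]val_last => kp; rewrite ltn_eqF. Qed.

Lemma last_cases (k : 'I_n) : k = last \/ (k < p)%N.
Proof.
have [kp|kp] := ltnP k p; [by right | left; apply: ord_inj].
by rewrite val_last; apply/eqP; rewrite eqn_leq kp -ltnS ltn_ord.
Qed.

Lemma comb_coord A d (k : 'I_n) : (k < p)%N ->
  comb A d k 0 = ((k \in A) (+) (inord k.+1 \in A))%:R.
Proof.
move=> kp; rewrite mxE sum_bar_coord // mulmxnE charvec_coord neq_last //.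
by rewrite mul0rn addr0 F2_add_bool.
Qed.

Lemma comb_last A d : comb A d last 0 = (odd (#|A :&: Q| + d))%:R.
Proof.
rewrite mxE sum_bar_last mulmxnE charvec_coord eqxx oddD oddb -F2_add_bool.
by case: d.
Qed.

Lemma comb_add A d A' d' :
  comb A d + comb A' d' = comb (symdiff A A') (d (+) d').
Proof.
rewrite /comb addrACA; congr (_ + _); last first.
  by case: d d' => [] []; rewrite ?addr0 ?add0r ?mxF2_addrr.
rewrite ![\sum_(i in _) _]big_mkcond -big_split; apply: eq_bigr => i _ /=.
rewrite inE; case: (i \in A); case: (i \in A') => //=.
- exact: mxF2_addrr.
- exact: addr0.
- exact: add0r.
- exact: addr0.
Qed.

Lemma comb_set1 i : comb [set i] false = b i.
Proof. by rewrite /comb big_set1 addr0. Qed.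

Lemma flip_path_comb (i : 'I_n) A d : (i < p)%N ->
  flip e i *m comb A d = comb [set tperm i (inord i.+1) j | j in A] d.
Proof.
move=> ip; rewrite /comb mulmxDr mulmx_sumr big_imset /=; last first.
  by move=> x y _ _ /perm_inj.
congr (_ + _); first by apply: eq_bigr => j _; rewrite flip_path_bar.
case: d; last by rewrite mulr0n mulmx0.
by rewrite mulr1n flip_mulE // charvec_coord neq_last // scale0r addr0.
Qed.

Definition initset (k : nat) : {set 'I_n} := [set i : 'I_n | (i < k)%N].

Lemma card_initset k : (k <= n)%N -> #|initset k| = k.
Proof.
move=> kn; rewrite -[RHS](card_ord k) -sum1_card -[RHS]sum1_card.
rewrite (big_ord_widen n (fun=> 1%N) kn).
by apply: eq_bigl => i; rewrite inE.
Qed.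

(** The coordinate at s_n of the sum of the first k bars; [Iset] and [Jset] test it. *)
Definition parity k := odd #|initset k :&: Q|.

(** * From sets of bars to sets of indices *)

Hypothesis p_gt1 : (1 < p)%N.

Lemma barv_inj : injective b.
Proof.
suff b_lt (i j : 'I_n) : (i < j)%N -> b i <> b j.
  move=> i j bij; apply/ord_inj; case: (ltngtP i j) => // /b_lt; first by [].
  by move/(_ (esym bij)).
move=> ij bij.
have coord k : (k < p)%N ->
    ((k == i) || (k.+1 == i)) = ((k == j) || (k.+1 == j)).
  move=> kp; have kE : @inord p k = k :> nat by rewrite inordK // ltnW.
  have := congr1 (fun v : vec => v (@inord p k) 0) bij.
  rewrite /barv !bar_coord ?kE //; try by rewrite -ltnS.
  exact: F2_bool_inj.
(* For i > 0, coordinate i - 1 separates the two bars. For i = 0, coordinate 0 does unless j = 1,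
   and then coordinate 1 does, which is on the path by [p_gt1]. *)
have jn := ltn_ord j; have := coord i.
case: (posnP i) => [i0 | i_gt0]; last by have := coord i.-1; lia.
by have := coord 1%N; rewrite i0; lia.
Qed.

Lemma barsE k : (k <= n)%N -> bars e k = [set b i | i in initset k].
Proof.
move=> kn; apply/setP => v; rewrite inE.
apply/mapP/imsetP => -[i].
  rewrite mem_iota add1n; case: i => // i /andP[_]; rewrite ltnS => ik ->.
  have iE : @inord p i = i :> nat by rewrite inordK // (leq_trans ik).
  by exists (inord i); rewrite ?inE /barv iE.
by rewrite inE => ik ->; exists i.+1; rewrite // mem_iota add1n.
Qed.

Lemma initset_n : initset n = setT.
Proof. by apply/setP => i; rewrite !inE ltn_ord. Qed.

Lemma PiE : Pi e = [set b i | i in 'I_n].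
Proof.
rewrite /Pi barsE // initset_n; apply/setP => v.
by apply/imsetP/imsetP => -[i _ ->]; exists i.
Qed.

Lemma dot_charvec (v : vec) (s : 'I_n) : dot v (charvec s) = v s 0.
Proof.
rewrite /dot mxE (bigD1 s) //= big1 => [|i i_s].
  by rewrite !mxE eqxx mulr1 addr0.
by rewrite [charvec s i 0]charvec_coord (negbTE i_s) mulr0.
Qed.

Lemma Pi1E : Pi1 e = b @: Q.
Proof.
apply/setP => v; rewrite /Pi1 /Pi0 PiE !inE dot_charvec.
apply/andP/imsetP => [[vPi1 /imsetP[i _ vE]]|[i iQ ->]].
  by exists i => //; move: vPi1; rewrite vE inE imset_f.
by rewrite imset_f //; split=> //; move: iQ; rewrite inE.
Qed.

Lemma card_Pi1 : #|Pi1 e| = #|Q|.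
Proof. by rewrite Pi1E card_imset //; exact: barv_inj. Qed.

Lemma odd_bars_Pi1 k : (k <= n)%N -> odd #|bars e k :&: Pi1 e| = parity k.
Proof.
move=> kn; rewrite barsE // Pi1E -imsetI; last by move=> ? ? _ _ /barv_inj.
by rewrite card_imset //; exact: barv_inj.
Qed.

(** * The move of s_n; uniqueness of (A, d) up to complement of A *)

Hypothesis Q_even : ~~ odd #|Q|.

(** On the path this is [nbr_last_coord]; at s_n, which is not its own neighbour, it is the evenness
    of |Q|. *)
Lemma nbr_last : nbr last = comb Q false.
Proof.
apply/matrixP => k j; rewrite (ord1 j).
have [->|kp] := last_cases k.
  by rewrite mxE e_irr comb_last setIid addn0 (negbTE Q_even).
by rewrite nbr_last_coord // comb_coord // F2_add_bool.
Qed.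

Lemma flip_last_comb A d : flip e last *m comb A d =
  if odd (#|A :&: Q| + d) then comb (symdiff A Q) d else comb A d.
Proof.
rewrite flip_mulE // comb_last; case: ifP => _.
  by rewrite scale1r nbr_last comb_add addbF.
by rewrite scale0r addr0.
Qed.

(** In other words the bars sum to 0: each path vertex is lit in exactly two bars, and s_n in |Q|
    bars, an even number. *)
Lemma comb_setC A d : comb (~: A) d = comb A d.
Proof.
apply/matrixP => k j; rewrite (ord1 j).
have [->|kp] := last_cases k; last first.
  by rewrite !comb_coord // !inE; case: (_ \in A); case: (_ \in A).
rewrite !comb_last; congr (_%:R); congr nat_of_bool.
rewrite !oddD; congr (_ (+) _).
have := cardsID A Q; rewrite setIC setDE [Q :&: ~: A]setIC => Qcard.
by move: Q_even; rewrite -Qcard oddD; case: (odd _); case: (odd _).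
Qed.

(** Vanishing at the path vertices makes membership in A the same for consecutive indices, hence
    constant. As |Q| is even, the coordinate at s_n is then d. *)
Lemma comb_eq0 A d : comb A d = 0 -> d = false /\ (A = set0 \/ A = setT).
Proof.
move=> A0.
have A_const (k : 'I_n) : (k \in A) = (ord0 \in A).
  case: k => k; elim: k => [|k IH] kn; first by congr (_ \in A); exact: val_inj.
  have kp : (k < p)%N by [].
  have := comb_coord A d (k := Ordinal (ltnW kn)) kp.
  rewrite A0 mxE => /esym/(@F2_bool_inj _ false)/negbT.
  rewrite IH negb_add => /eqP->.
  by congr (_ \in A); apply: ord_inj; rewrite inordK.
have Acase : A = set0 \/ A = setT.
  case: (boolP (ord0 \in A)) => A_0; [right|left]; apply/setP => k.
    by rewrite A_const A_0 inE.
  by rewrite A_const (negbTE A_0) inE.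
split=> //; have := comb_last A d.
rewrite A0 mxE => /esym/(@F2_bool_inj _ false).
by case: Acase => ->; rewrite ?set0I ?setTI ?cards0 oddD ?(negbTE Q_even) oddb.
Qed.

Lemma comb_inj A d A' d' :
  comb A d = comb A' d' -> d = d' /\ (A = A' \/ A = ~: A').
Proof.
move=> AA'.
have/comb_eq0[/negbT] : comb (symdiff A A') (d (+) d') = 0.
  by rewrite -comb_add AA' mxF2_addrr.
rewrite negb_add => /eqP -> AcA; split=> //.
case: AcA => [/setP S|/setP S]; [left|right]; apply/setP => k.
  by have := S k; rewrite !inE => /negbT; rewrite negb_add => /eqP.
by have := S k; rewrite !inE => /addbP <-; rewrite negbK.
Qed.

Lemma comb00 : comb set0 false = 0.
Proof. by rewrite /comb big_set0 addr0. Qed.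

(** On the path the sum of the first bars telescopes to its last vertex; the boolean cancels the
    coordinate at s_n. *)
Lemma charvec_path (k : 'I_n) : (k < p)%N ->
  charvec k = comb (initset k.+1) (parity k.+1).
Proof.
move=> kp; apply/matrixP => i j; rewrite (ord1 j) charvec_coord.
have [->|ip] := last_cases i.
  rewrite eq_sym neq_last // comb_last oddD oddb.
  by rewrite /parity addbb.
rewrite comb_coord // !inE inordK // !ltnS -val_eqE.
by congr (_%:R); congr nat_of_bool => /=; lia.
Qed.

Lemma charvec_last : charvec last = comb set0 true.
Proof. by rewrite /comb big_set0 add0r. Qed.

Lemma comb_surj (u : vec) : exists A d, u = comb A d.
Proof.
have -> : u = \sum_k u k 0 *: charvec k.
  by rewrite {1}[u]matrix_sum_delta; apply: eq_bigr => i _; rewrite big_ord1.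
apply: (big_ind (fun u => exists A d, u = comb A d)).
- by exists set0, false; rewrite comb00.
- move=> _ _ [A [d ->]] [A' [d' ->]]; rewrite comb_add.
  by exists (symdiff A A'), (d (+) d').
move=> k _; rewrite [u k 0]F2_boolE; case: (_ != _); last first.
  by exists set0, false; rewrite comb00 scale0r.
rewrite scale1r; have [->|kp] := last_cases k.
  by exists set0, true; rewrite charvec_last.
by exists (initset k.+1), (parity k.+1); rewrite charvec_path.
Qed.

Lemma comb_inU A d : (comb A d \in U e) = ~~ d.
Proof.
rewrite inE PiE; apply/idP/idP => [|d0].
  move/(@coord_span _ _ _ (in_tuple _)) => cE.
  (* The span contains only sums of bars, so [comb_inj] excludes s_n. *)
  suff [A' cA'] : exists A', comb A d = comb A' false.
    by have [->] := comb_inj cA'.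
  rewrite cE; apply: (big_ind (fun u => exists A', u = comb A' false)).
  - by exists set0; rewrite comb00.
  - move=> _ _ [A1 ->] [A2 ->]; rewrite comb_add.
    by exists (symdiff A1 A2).
  move=> i _; set c := coord _ _ _; rewrite [c]F2_boolE.
  case: (_ != _); last by exists set0; rewrite scale0r comb00.
  have/imsetP[j _ ->] :
      (enum [set b j | j in 'I_n])`_i \in [set b j | j in 'I_n].
    by rewrite -mem_enum mem_nth.
  by exists [set j]; rewrite scale1r comb_set1.
rewrite /comb (negbTE d0) addr0; apply: memv_suml => i _.
by apply: memv_span; rewrite mem_enum imset_f.
Qed.

(** * The basis Delta and the function sw *)

Lemma barv_neq_last i : b i != charvec last.
Proof.
apply/eqP; rewrite -comb_set1 charvec_last.
by move/comb_inj => [].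
Qed.

Lemma DeltaE : Delta e = charvec last |: [set b i | i in ~: [set last]].
Proof.
have lastE : bar e n = b last by rewrite /barv val_last.
apply/setP => v; rewrite /Delta PiE lastE !inE; apply/andP/orP.
  case=> vn /orP[->|/imsetP[i _ vE]]; [by left | right].
  apply/imsetP; exists i => //; rewrite !inE.
  by apply: contra vn => /eqP <-; rewrite vE.
case=> [/eqP ->|/imsetP[i]].
  by rewrite eq_sym barv_neq_last eqxx.
rewrite !inE => il ->; rewrite imset_f // orbT; split=> //.
by apply: contra il => /eqP/barv_inj ->.
Qed.

(** With [sub_Delta], this matches subsets of [Delta] with pairs (A, d) where A avoids [last], the
    index of the omitted bar. *)
Lemma sum_Delta (A : {set 'I_n}) (d : bool) : last \notin A ->
  let D := if d then charvec last |: (b @: A) else b @: A in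
  [/\ D \subset Delta e, \sum_(v in D) v = comb A d & #|D| = (#|A| + d)%N].
Proof.
move=> lA D.
have AD : b @: A \subset Delta e.
  apply/subsetP => _ /imsetP[i iA ->].
  rewrite DeltaE inE imset_f ?orbT // !inE.
  by apply: contraNneq lA => <-.
have lb : charvec last \notin b @: A.
  by apply/imsetP => -[i _ /eqP]; rewrite eq_sym (negbTE (barv_neq_last i)).
have sumA : \sum_(v in b @: A) v = \sum_(i in A) b i.
  by rewrite big_imset //= => i j _ _ /barv_inj.
have cardA : #|b @: A| = #|A| by rewrite card_imset //; exact: barv_inj.
rewrite /D; case: d {D}; split=> //.
- by rewrite subUset AD DeltaE sub1set setU11.
- by rewrite big_setU1 //= sumA addrC.
- by rewrite cardsU1 lb cardA addn1.
- by rewrite sumA /comb addr0.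
- by rewrite cardA addn0.
Qed.

Lemma sub_Delta (D : {set vec}) : D \subset Delta e ->
  exists (A : {set 'I_n}) d, last \notin A /\
    D = if d then charvec last |: (b @: A) else b @: A.
Proof.
move=> /subsetP sD; exists [set i : 'I_n | (b i \in D) && (i != last)].
exists (charvec last \in D); split; first by rewrite inE eqxx andbF.
have inA v : v \in D -> v != charvec last ->
    v \in b @: [set i : 'I_n | (b i \in D) && (i != last)].
  move=> vD vl; have := sD v vD; rewrite DeltaE inE inE (negbTE vl) /=.
  case/imsetP => i; rewrite !inE => il vE; apply/imsetP; exists i => //.
  by rewrite inE -vE vD.
apply/setP => v; apply/idP/idP => vD.
  case: ifP => lD; rewrite ?in_setU1.
    by have [//|vl /=] := eqVneq v (charvec last); exact: inA.
  by apply: inA => //; apply: contraFneq lD => <-.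
have AD : v \in b @: [set i : 'I_n | (b i \in D) && (i != last)] -> v \in D.
  by case/imsetP => i; rewrite inE => /andP[iD _] ->.
by move: vD; case: ifP => // lD; rewrite in_setU1 => /orP[/eqP->//|/AD].
Qed.

(** The set picked by [Delta_supp] is forced: by [comb_inj] the only other candidate for A is its
    complement, which contains [last]. *)
Lemma sw_comb (A : {set 'I_n}) d : last \notin A ->
  sw e (comb A d) = (#|A| + d)%N.
Proof.
move=> lA; rewrite /sw /Delta_supp.
have [sD sumD cD] := sum_Delta d lA.
case: pickP => [D' /andP[sD' /eqP sumD']|none]; last first.
  have := none (if d then charvec last |: (b @: A) else b @: A).
  by rewrite sD sumD eqxx.
have [A' [d' [lA' D'E]]] := sub_Delta sD'.
have [_ sumD'E cD'] := sum_Delta d' lA'.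
rewrite /= D'E cD'; move: sumD'; rewrite D'E sumD'E.
move/comb_inj => [-> [->//|AE]].
by move: lA'; rewrite AE inE lA.
Qed.

(** * The orbit depends only on d and the number of bars *)

Lemma orb_swap (i : 'I_n) (A : {set 'I_n}) d : (i < p)%N ->
  orb (comb [set tperm i (inord i.+1) j | j in A] d) = orb (comb A d).
Proof. by move=> ip; rewrite -flip_path_comb // orb_flip. Qed.

Lemma initset_card (A : {set 'I_n}) :
  (forall i : 'I_n, (i < p)%N -> inord i.+1 \in A -> i \in A) ->
  A = initset #|A|.
Proof.
move=> A_pred.
have A_down m (i j : 'I_n) : (j + m)%N = i -> i \in A -> j \in A.
  elim: m j => [|m IH] j; first by rewrite addn0 => /ord_inj ->.
  rewrite -addSnnS => jmi iA; have jp : (j < p)%N by have := ltn_ord i; lia.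
  by apply: A_pred => //; apply: IH iA; rewrite inordK.
apply/setP => i; rewrite inE.
have [iA|iA] := boolP (i \in A); apply/esym.
  rewrite -(card_initset (ltn_ord i)); apply: subset_leq_card.
  apply/subsetP => j; rewrite inE ltnS => ji.
  by apply: (A_down (i - j)%N i); rewrite ?subnKC.
apply/negbTE; rewrite -leqNgt -(card_initset (ltnW (ltn_ord i))).
apply: subset_leq_card; apply/subsetP => j jA; rewrite inE ltnNge.
by apply: contra iA => ij; apply: (A_down (j - i)%N j); rewrite ?subnKC.
Qed.

(** Path moves act on indices as adjacent transpositions, so A can be sorted: as long as some i
    outside A has i + 1 in A, exchanging them lowers the sum of the indices. Otherwise A is an
    initial segment. *)
Lemma orb_card (A : {set 'I_n}) d :
  orb (comb A d) = orb (comb (initset #|A|) d).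
Proof.
have [m] := ubnP (\sum_(i in A) i)%N; elim: m A => // m IH A A_lt.
case: (pickP [pred i : 'I_n | [&& i < p, i \notin A & inord i.+1 \in A]%N]).
  move=> i /and3P[ip iA sA]; rewrite -(orb_swap A d ip).
  have cA : #|[set tperm i (inord i.+1) j | j in A]| = #|A|.
    by apply: card_imset; apply: perm_inj.
  rewrite -cA; apply: IH.
  rewrite big_imset /=; last by move=> x y _ _ /perm_inj.
  rewrite -ltnS (leq_trans _ A_lt) // ltnS.
  rewrite (bigD1 _ sA) [X in (_ < X)%N](bigD1 _ sA) /= tpermR.
  rewrite inordK // -addSn leq_add // leq_eqVlt; apply/orP; left; apply/eqP.
  apply: eq_bigr => j /andP[jA js]; rewrite tpermD // 1?eq_sym //.
  by apply: contraNneq iA => <-.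
move=> none; rewrite -initset_card // => i ip sA.
by have := none i; rewrite /= ip sA andbT => /negbFE.
Qed.

Definition orb_of d k := orb (comb (initset k) d).

Lemma orb_of_card (A : {set 'I_n}) d k :
  #|A| = k -> orb (comb A d) = orb_of d k.
Proof. by move=> <-; exact: orb_card. Qed.

Lemma orb_of_compl d k : (k <= n)%N -> orb_of d k = orb_of d (n - k).
Proof.
move=> kn; rewrite {1}/orb_of -comb_setC; apply: orb_of_card.
by rewrite cardsCs setCK card_ord card_initset.
Qed.

(** * Identification of orbits through the move of s_n *)

Variable q : nat.
Hypothesis card_Q : #|Q| = q.
Hypothesis q_ge4 : (4 <= q)%N.
Hypothesis q_le : (q + 3 <= n)%N.

Lemma q_even : ~~ odd q.
Proof. by rewrite -card_Q. Qed.

(** Take a indices outside Q and t inside. As t + d is odd, the move of s_n acts, and it replaces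
    the t indices with the other q - t of Q. *)
Lemma orb_of_flip (d : bool) a t : (a + q <= n)%N -> (t <= q)%N ->
  odd (t + d) -> orb_of d (a + t) = orb_of d (a + (q - t)).
Proof.
move=> an tq t_odd.
have [|A1 A1Q A1a] := @exists_subset_card _ (~: Q) a.
  by rewrite cardsCs setCK card_ord card_Q; lia.
have [|A2 A2Q A2t] := @exists_subset_card _ Q t; first by rewrite card_Q.
have AQ : (A1 :|: A2) :&: Q = A2.
  rewrite setIUl (setIidPl A2Q); apply/setUidPr/subsetP => x.
  by rewrite inE => /andP[/(subsetP A1Q)]; rewrite inE => /negbTE->.
have cA : #|A1 :|: A2| = (a + t)%N.
  rewrite cardsU A1a A2t -[RHS]subn0; congr (_ - _)%N; apply/eqP.
  rewrite cards_eq0 -subset0; apply/subsetP => x; rewrite inE => /andP[x1 x2].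
  by have := subsetP A1Q _ x1; rewrite inE (subsetP A2Q _ x2).
rewrite -(orb_of_card d cA) -(orb_flip last) flip_last_comb AQ A2t t_odd.
apply: orb_of_card; have := card_symdiff (A1 :|: A2) Q.
by rewrite AQ cA A2t card_Q; lia.
Qed.

(** Without s_n, this excludes 0 and n bars, both of which sum to the zero vector. *)
Definition in_range (d : bool) k := (~~ d <= k <= n - ~~ d)%N.

Lemma orb_of_add4 d k : in_range d k -> in_range d (k + 4) ->
  orb_of d k = orb_of d (k + 4).
Proof.
move=> k1 k2.
have [t [tk tQ kQ t_odd]] := exists_split q_even q_ge4 q_le k1 k2.
have <- : (k - t + t)%N = k by rewrite subnK.
rewrite orb_of_flip //; try lia.
(* Only the number of bars matters, so two of them may be regrouped as lying outside Q; the second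
   exchange turns the remaining q - t - 2 into t + 2. *)
have -> : (k - t + (q - t) = k - t + 2 + (q - t - 2))%N by lia.
rewrite orb_of_flip //; try lia.
by congr orb_of; lia.
Qed.

Lemma orb_of_mod4 d k k' : in_range d k -> in_range d k' -> k = k' %[mod 4] ->
  orb_of d k = orb_of d k'.
Proof.
wlog kk' : k k' / (k <= k')%N => [H k1 k'1 kmod|].
  by have [/H|/ltnW/H] := leqP k k'; [exact | move/(_ k'1 k1 (esym kmod))].
move=> k1 k'1 kmod.
have [m k'E] : exists m, k' = (k + 4 * m)%N.
  by exists ((k' - k) %/ 4)%N; lia.
move: k'1; rewrite {}k'E {kk' kmod k'}; elim: m => [|m IH] k'1.
  by rewrite muln0 addn0.
rewrite IH; last by move: k'1 k1; rewrite /in_range; lia.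
have -> : (k + 4 * m.+1 = k + 4 * m + 4)%N by lia.
apply: orb_of_add4.
  by move: k'1 k1; rewrite /in_range; lia.
by move: k'1 k1; rewrite /in_range; lia.
Qed.

Lemma exists_small d i : exists2 r, (~~ d <= r <= ~~ d + 3)%N & r = i %[mod 4].
Proof.
(* Without s_n, residue 0 is represented by 4, since 0 is out of range. *)
exists (if d || (i %% 4 != 0) then i %% 4 else 4)%N;
  last by case: ifP => ?; lia.
by case: d => /=; first lia; case: ifP => ?; lia.
Qed.

Lemma small_in_range d i : (~~ d <= i <= ~~ d + 3)%N -> in_range d i.
Proof. by rewrite /in_range; case: d => /=; lia. Qed.

(** One exchange suffices, with t = 1 if d is false and t = 0 if d is true. Passing first to a small
    r leaves room for the q indices of Q. *)
Lemma orb_of_shift d i : in_range d i ->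
  exists s, [/\ in_range d s, s = i + q + 2 + 2 * d %[mod 4]
    & orb_of d s = orb_of d i]%N.
Proof.
move=> i1; have [r r_small r_i] := exists_small d i.
have r1 := small_in_range r_small.
exists (if d then r + q else r + q - 2)%N.
have -> : orb_of d i = orb_of d (r - ~~ d + ~~ d).
  by rewrite subnK; [exact: orb_of_mod4 | case/andP: r1].
rewrite orb_of_flip; last 3 first.
- by move: r_small; case: (d) => /=; lia.
- by case: (d) => /=; lia.
- by case: (d).
split.
- by move: r_small; rewrite /in_range; case: (d) => /=; lia.
- by move: r_small r_i; case: (d) => /=; lia.
by congr orb_of; move: r_small; case: (d) => /=; lia.
Qed.

(** The four alternatives are equality mod 4, possibly after a shift, a complement, or both. *)
Lemma orb_of_same d k i : in_range d k -> in_range d i ->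
  same_class n q d k i -> orb_of d k = orb_of d i.
Proof.
move=> k1 i1; have compl1 j : in_range d j -> in_range d (n - j).
  by rewrite /in_range; case: d {k1 i1} => /=; lia.
have compl j : in_range d j -> orb_of d j = orb_of d (n - j).
  by move=> j1; apply: orb_of_compl; case/andP: j1 => _; lia.
have le_n j : in_range d j -> (j <= n)%N by case/andP => _; lia.
have [s [s1 s_i s_eq]] := orb_of_shift i1.
case/or4P => /eqP ki.
- exact: orb_of_mod4.
- by rewrite -s_eq; apply: orb_of_mod4 => //; rewrite ki s_i.
- rewrite [RHS]compl //; apply: orb_of_mod4 => //; first exact: compl1.
  by have := le_n _ i1; lia.
rewrite -s_eq [RHS]compl //; apply: orb_of_mod4 => //; first exact: compl1.
by have := le_n _ s1; move: q_even; lia.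
Qed.

(** * The candidates for the nonzero orbits *)

Definition part d i : {set vec} :=
  [set comb A d | A : {set 'I_n} &
     in_range d #|A| && same_class n q d #|A| i].

Lemma card_ord_set_le (A : {set 'I_n}) : (#|A| <= n)%N.
Proof. by rewrite -[n in (_ <= n)%N]card_ord max_card. Qed.

Lemma card_ord_setC (A : {set 'I_n}) : #|~: A| = (n - #|A|)%N.
Proof. by rewrite cardsCs setCK card_ord. Qed.

Lemma in_range_compl (A : {set 'I_n}) d :
  in_range d #|~: A| = in_range d #|A|.
Proof.
rewrite card_ord_setC; move: #|A| (card_ord_set_le A) => k kn.
by rewrite /in_range; case: d => /=; lia.
Qed.

Lemma same_class_compl (A : {set 'I_n}) d i :
  same_class n q d #|~: A| i = same_class n q d #|A| i.
Proof.
rewrite card_ord_setC; move: #|A| (card_ord_set_le A) => k kn.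
by rewrite /same_class; move: q_even; case: d => /=; lia.
Qed.

(** By [comb_inj] A is known up to complement, and complementing A changes neither condition on its
    cardinal. *)
Lemma mem_part A d d' i : (comb A d \in part d' i) =
  [&& d == d', in_range d #|A| & same_class n q d #|A| i].
Proof.
apply/imsetP/and3P => [[A']|[/eqP <- A1 Ai]];
  last by exists A; rewrite ?inE ?A1.
rewrite inE => /andP[A1 Ai] /comb_inj[-> AA']; split=> //.
  by case: AA' => ->; rewrite ?in_range_compl.
by case: AA' => ->; rewrite ?same_class_compl.
Qed.

Lemma part_flip d i s v : v \in part d i -> flip e s *m v \in part d i.
Proof.
case/imsetP => A; rewrite inE => /andP[A1 Ai] ->.
have [->|sp] := last_cases s; last first.
  rewrite flip_path_comb // mem_part eqxx card_imset ?A1 //.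
  exact: perm_inj.
rewrite flip_last_comb; case: ifP => AQ; rewrite mem_part eqxx ?A1 //=.
(* With t = |A :&: Q| and t + d odd, the new cardinal |A| + q - 2t is |A| + q + 2 + 2d mod 4. If d
   is false, t is odd, hence neither 0 nor q, and the new set is neither full nor empty. *)
have := card_symdiff A Q; have := cardsUI A Q.
have : (#|A :&: Q| <= #|Q|)%N by rewrite subset_leq_card ?subsetIr.
have : (#|A :&: Q| <= #|A|)%N by rewrite subset_leq_card ?subsetIl.
move: (card_ord_set_le (A :|: Q)) AQ A1 Ai; rewrite card_Q.
move: #|A| #|A :&: Q| #|A :|: Q| #|symdiff A Q| => a t u s'.
by move: q_even; rewrite /in_range /same_class; case: d => /=; lia.
Qed.

Lemma orb_of_part d i : (~~ d <= i <= ~~ d + 3)%N -> orb_of d i = part d i.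
Proof.
move=> i_small; have i1 := small_in_range i_small.
have i_n : (i <= n)%N by case/andP: i1 => _ /leq_trans; apply; exact: leq_subr.
apply: orb_part; first exact: part_flip.
  move=> _ _ /imsetP[A + ->] /imsetP[A' + ->]; rewrite !inE.
  move=> /andP[A1 Ai] /andP[A'1 A'i].
  by rewrite (orb_card A) (orb_card A') -!/(orb_of _ _) !(@orb_of_same d _ i).
rewrite mem_part eqxx card_initset // i1 /same_class.
by rewrite eqxx.
Qed.

Lemma comb_surj_wlog u :
  exists (A : {set 'I_n}) d, last \notin A /\ u = comb A d.
Proof.
have [A [d uE]] := comb_surj u.
have [lA|lA] := boolP (last \in A); last by exists A, d.
by exists (~: A), d; rewrite inE lA comb_setC.
Qed.

Lemma card_lt_notin (A : {set 'I_n}) : last \notin A -> (#|A| < n)%N.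
Proof.
move=> lA; rewrite -[n in (_ < n)%N](card_ord n) -cardsT; apply: proper_card.
by rewrite properE subsetT; apply: contra lA => /subsetP; apply.
Qed.

(** * Comparison with the sets B_i and C_i *)

Lemma BsetE i j : (1 <= i <= 4)%N ->
  Bset e i j = in_range false j && same_class n q false j i.
Proof.
move=> i4; rewrite /Bset card_Pi1 card_Q /= /in_range /same_class.
by congr (_ && [|| _, _, _ | _]); lia.
Qed.

Lemma CsetE i j : (1 <= i <= 4)%N ->
  Cset e i j = (1 <= j <= n)%N && same_class n q true j.-1 i.-1.
Proof.
move=> i4; rewrite /Cset card_Pi1 card_Q /= /same_class.
case: (posnP j) => [-> // | j_gt0].
by congr (_ && [|| _, _, _ | _]); lia.
Qed.

Lemma sw_part_U i : (1 <= i <= 4)%N ->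
  sw_part e (U e) (Bset e i) = part false i.
Proof.
move=> i4; apply/setP => u; have [A [d [lA ->]]] := comb_surj_wlog u.
by rewrite mem_part inE comb_inU sw_comb // BsetE //; case: d; rewrite ?addn0.
Qed.

Lemma sw_part_Ubar i : (1 <= i <= 4)%N ->
  sw_part e (Ubar e) (Cset e i) = part true i.-1.
Proof.
move=> i4; apply/setP => u; have [A [d [lA ->]]] := comb_surj_wlog u.
rewrite mem_part inE inE comb_inU sw_comb // CsetE //; case: d => //=.
have A_n := card_lt_notin lA.
by rewrite addn1 /= A_n /in_range /= subn0 ltnW.
Qed.

(** * Counting the orbits *)

Lemma class_repsP d i : ((d, i) \in class_reps) = (~~ d <= i <= ~~ d + 3)%N.
Proof. by case: d i => [] [|[|[|[|[|i]]]]]. Qed.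

Lemma small_le_n d i : (~~ d <= i <= ~~ d + 3)%N -> (i <= n)%N.
Proof. by case: d => /=; lia. Qed.

Lemma comb_initset_part d i : (~~ d <= i <= ~~ d + 3)%N ->
  comb (initset i) d \in part d i.
Proof.
move=> i1; rewrite mem_part eqxx card_initset ?(small_le_n i1) //.
by rewrite small_in_range // /same_class eqxx.
Qed.

(** Each orbit is a part, and a part determines d and the class of its representative; this makes
    equality of orbits computable. *)
Lemma orb_of_eqE x y : x \in class_reps -> y \in class_reps ->
  (orb_of x.1 x.2 == orb_of y.1 y.2) = (class_key n q x == class_key n q y).
Proof.
case: x y => [d i] [d' j]; rewrite !class_repsP /= => i1 j1.
have [dd'|dd'] := eqVneq d d'; last first.
  rewrite xpair_eqE (negbTE dd') /=; apply/negbTE; apply: contra dd' => /eqP ij.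
  have := comb_initset_part i1; rewrite -orb_of_part // ij orb_of_part //.
  by rewrite mem_part => /and3P[].
rewrite -{d'}dd' in j1 *.
rewrite eq_class_key ?q_even //; apply/eqP/idP => [ij|ij].
  have := comb_initset_part i1; rewrite -orb_of_part // ij orb_of_part //.
  by rewrite mem_part card_initset ?(small_le_n i1) // => /and3P[].
by apply: orb_of_same => //; exact: small_in_range.
Qed.

Lemma orb0 : orb 0 = [set 0].
Proof.
apply: (orb_part (V := [set 0])) => [s v|v w|]; rewrite ?inE //.
  by move=> /eqP->; rewrite mulmx0.
by move=> /eqP-> /eqP->.
Qed.

Lemma part_neq0 d i : 0 \notin part d i.
Proof. by rewrite -comb00 mem_part cards0; case: d; rewrite ?andbF. Qed.

Lemma nontrivial_orbits :
  flip_orbits e :\ [set 0] = [set:: [seq orb_of x.1 x.2 | x <- class_reps]].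
Proof.
apply/setP => V; rewrite in_setD1 [RHS]inE; apply/andP/mapP.
  move=> [V0 /imsetP[u _ VE]]; have [A [d uE]] := comb_surj u.
  move: V0; rewrite {V}VE {u}uE => V0.
  (* Otherwise d is false and A is empty or full, and the vector is 0. *)
  have A1 : in_range d #|A|.
    apply: contraR V0 => A1; rewrite -orb0; apply/eqP; congr orb.
    move: A1; rewrite /in_range; case: d => /=.
      by rewrite subn0 card_ord_set_le.
    rewrite negb_and -leqNgt leqn0 cards_eq0 -ltnNge => /orP[/eqP->|A_n].
      exact: comb00.
    rewrite -comb_setC (_ : ~: A = set0) ?comb00 //; apply/eqP.
    by rewrite -cards_eq0 card_ord_setC subn_eq0; move: A_n; rewrite subn1.
  have [r r1 rA] := exists_small d #|A|.
  exists (d, r); first by rewrite class_repsP.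
  by rewrite orb_card; apply: orb_of_mod4 => //; exact: small_in_range.
move=> [[d i]]; rewrite class_repsP => i1 ->; split; last exact: imset_f.
rewrite orb_of_part //; apply: contraNneq (part_neq0 d i) => ->.
by rewrite inE.
Qed.

Lemma card_orbits : #|flip_orbits e| = if odd n then 4 else 6.
Proof.
rewrite (cardsD1 [set 0]) nontrivial_orbits card_set_seq.
rewrite (size_undup_map orb_of_eqE) count_classes ?q_even //.
have -> : [set 0] \in flip_orbits e by rewrite -orb0; apply: imset_f.
by case: odd.
Qed.

(** * Minimal weights in the orbits *)

Lemma weight0 : weight (0 : vec) = 0%N.
Proof.
apply/eqP; rewrite cards_eq0; apply/eqP/setP => i.
by rewrite !inE mxE eqxx.
Qed.

Lemma weight_eq0 (u : vec) : weight u = 0%N -> u = 0.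
Proof.
move/eqP; rewrite cards_eq0 => /eqP/setP u0; apply/matrixP => i j.
by rewrite (ord1 j) mxE; have := u0 i; rewrite !inE => /negbFE/eqP.
Qed.

Lemma weight_charvec (s : 'I_n) : weight (charvec s) = 1%N.
Proof.
rewrite -(cards1 s); apply: eq_card => i; rewrite !inE charvec_coord.
by case: (i == s).
Qed.

Lemma weight1 (u : vec) : weight u = 1%N -> exists s, u = charvec s.
Proof.
move/eqP/cards1P => [s /setP us]; exists s; apply/matrixP => i j.
rewrite (ord1 j) charvec_coord [u i 0]F2_boolE.
by have := us i; rewrite !inE => ->.
Qed.

Lemma weightD (u v : vec) : (weight (u + v) <= weight u + weight v)%N.
Proof.
apply: leq_trans (leq_card_setU _ _); apply: subset_leq_card.
apply/subsetP => i; rewrite !inE mxE -negb_and; apply: contra.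
by move=> /andP[/eqP-> /eqP->]; rewrite addr0.
Qed.

Lemma min_weight_le (V : {set vec}) u : u \in V -> (min_weight V <= weight u)%N.
Proof.
rewrite /min_weight => uV.
have : u \in index_enum _ := mem_index_enum u.
elim: (index_enum _) => // v r IH; rewrite inE big_cons => /orP[/eqP <-|ur].
  by rewrite uV geq_minl.
by case: ifP => _; [apply: leq_trans (geq_minr _ _) _|]; exact: IH.
Qed.

Lemma min_weight_ge (V : {set vec}) w : (w <= n)%N ->
  (forall u, u \in V -> w <= weight u)%N -> (w <= min_weight V)%N.
Proof.
move=> wn wV; rewrite /min_weight; elim/big_ind: _ => // a c wa wc.
by rewrite leq_min wa.
Qed.

Lemma min_weight_le1 (V : {set vec}) : 0 \notin V -> (min_weight V <= 1)%N ->
  exists s, charvec s \in V.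
Proof.
move=> V0 V1; apply/existsP; apply: contraLR V1.
rewrite negb_exists => /forallP noV.
(* The default value n of the minimum is at least 2 as well. *)
rewrite -ltnNge; apply: min_weight_ge => [|u uV]; first exact: ltnW.
rewrite ltnNge.
apply/negP; rewrite leq_eqVlt ltnS leqn0.
case/orP => /eqP; [case/weight1=> s us | move/weight_eq0 => u0].
  by have := noV s; rewrite -us uV.
by move: V0; rewrite -u0 uV.
Qed.

(** By [charvec_path], s_j is made of the first j bars, and it avoids s_n exactly when j is in
    [Iset]. The vertex s_n itself lies outside U. *)
Lemma charvec_part_false i : (1 <= i <= 4)%N ->
  (exists s, charvec s \in part false i) <->
  (exists j, Bset e i j /\ Iset e j).
Proof.
move=> i4; split=> [[s]|[j []]].
  have [->|sp] := last_cases s; first by rewrite charvec_last mem_part.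
  rewrite charvec_path // mem_part card_initset ?(ltn_ord s) //.
  case/and3P => /eqP par; rewrite par => rng cls.
  exists s.+1; split; first by rewrite BsetE // rng.
  by rewrite /Iset /= sp odd_bars_Pi1 ?ltn_ord // par.
rewrite BsetE // => /andP[_ cls]; rewrite /Iset /= => /andP[/andP[j_gt0 jp]].
have jE : (@inord p j.-1).+1 = j by rewrite inordK ?prednK // ltnW.
have jn : (j <= n)%N by rewrite ltnW.
rewrite odd_bars_Pi1 // => par; exists (inord j.-1).
rewrite charvec_path ?jE // mem_part card_initset //.
by rewrite (negbTE par) cls /in_range /= j_gt0 subn1 jp.
Qed.

(** Since [Cset] counts s_n too, j corresponds to s_(j-1) and its j - 1 bars. The special value j =
    1 of [Jset] stands for s_n alone. *)
Lemma charvec_part_true i : (1 <= i <= 4)%N ->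
  (exists s, charvec s \in part true i.-1) <->
  (exists j, Cset e i j /\ Jset e j).
Proof.
move=> i4; split=> [[s]|[j []]].
  have [->|sp] := last_cases s.
    rewrite charvec_last mem_part cards0 => /and3P[_ _ cls].
    by exists 1%N; split; [rewrite CsetE | rewrite /Jset /= orbT].
  rewrite charvec_path // mem_part card_initset ?(ltn_ord s) //.
  case/and3P => /eqP par; rewrite par => _ cls.
  exists s.+2; split; first by rewrite CsetE //= ltnS sp.
  by rewrite /Jset /= ltnS sp odd_bars_Pi1 ?ltn_ord // par.
rewrite CsetE // /Jset /= => /andP[jn cls] /andP[_ /orP[|/eqP j1]]; last first.
  by exists last; rewrite charvec_last mem_part cards0; move: cls; rewrite j1.
case: j jn cls => // j /= jn cls; rewrite odd_bars_Pi1 ?(ltnW jn) // => par.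
case: j jn cls par => [|j] jn cls par.
  by move: par; rewrite /parity (_ : initset 0 = set0) ?set0I ?cards0 //;
     apply/setP => k; rewrite !inE.
have jE : @inord p j = j :> nat by rewrite inordK // ltnW.
exists (inord j); rewrite charvec_path ?jE // mem_part.
by rewrite card_initset ?(ltnW jn) // par cls /in_range /= subn0 (ltnW jn).
Qed.

(** By [charvec_path], the first i > 0 bars, with or without s_n, give s_i or s_i + s_n; for i = 0
    only s_n is left. *)
Lemma part_weight_le2 d i : (~~ d <= i <= ~~ d + 3)%N ->
  exists2 u, u \in part d i & (weight u <= 2)%N.
Proof.
move=> i1; have ui := comb_initset_part i1.
exists (comb (initset i) d) => //.
case: i i1 {ui} => [|i] i1.
  rewrite (_ : initset 0 = set0); last by apply/setP => k; rewrite !inE.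
  by case: d i1 => // _; rewrite -charvec_last weight_charvec.
have ip : (i < p)%N by case: d i1 => /=; lia.
have iE : @inord p i = i :> nat by rewrite inordK // ltnW.
have iC : comb (initset i.+1) d =
    charvec (inord i) + comb set0 (parity i.+1 (+) d).
  rewrite charvec_path ?iE // comb_add addKb; congr comb.
  by apply/setP => k; rewrite !inE addbF.
rewrite iC (leq_trans (weightD _ _)) // weight_charvec ltnS.
case: (_ (+) _); first by rewrite -charvec_last weight_charvec.
by rewrite comb00 weight0.
Qed.

Lemma flip_orbitsP V : V \in flip_orbits e ->
  V = [set 0] \/ exists d i, (~~ d <= i <= ~~ d + 3)%N /\ V = part d i.
Proof.
move=> VO; have [->|V0] := eqVneq V [set 0]; [by left | right].
have : V \in flip_orbits e :\ [set 0] by rewrite !inE V0.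
rewrite nontrivial_orbits inE => /mapP[[d i]]; rewrite class_repsP => i1 ->.
by exists d, i; rewrite orb_of_part.
Qed.

Lemma part_orbit d i : (~~ d <= i <= ~~ d + 3)%N -> part d i \in flip_orbits e.
Proof. by move=> i1; rewrite -orb_of_part //; apply: imset_f. Qed.

Lemma max_min_weight_le m : (0 < m)%N ->
    (forall d i, (~~ d <= i <= ~~ d + 3)%N ->
       exists2 u, u \in part d i & (weight u <= m)%N) ->
  (max_min_weight e <= m)%N.
Proof.
move=> m_gt0 small; apply/bigmax_leqP => V /flip_orbitsP[->|[d [i [i1 ->]]]].
  by rewrite (leq_trans (min_weight_le (set11 0))) ?weight0.
by have [u uV /(leq_trans (min_weight_le uV))] := small d i i1.
Qed.

Lemma max_min_weight_gt0 : (0 < max_min_weight e)%N.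
Proof.
apply: (@leq_trans (min_weight (part true 0))); last first.
  exact/leq_bigmax_cond/part_orbit.
apply: min_weight_ge => [//|u uV]; rewrite lt0n.
apply: contraNneq (part_neq0 true 0).
by move=> /weight_eq0 <-.
Qed.

(** The sets meet exactly when every nonzero orbit contains the characteristic vector of a vertex,
    that is, has minimal weight 1. *)
Lemma max_min_weight_cases :
  let all_meet := forall i, (1 <= i <= 4)%N ->
    (exists j, Bset e i j /\ Iset e j) /\ (exists j, Cset e i j /\ Jset e j) in
  (all_meet -> max_min_weight e = 1%N) /\
  (~ all_meet -> max_min_weight e = 2%N).
Proof.
move=> all_meet; split=> [meet|no_meet]; apply/eqP; rewrite eqn_leq.
  rewrite max_min_weight_gt0 andbT; apply: max_min_weight_le => // d i i1.
  suff [s s_in] : exists s, charvec s \in part d i.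
    by exists (charvec s); rewrite ?weight_charvec.
  case: d i1 => /= i1; last by apply/charvec_part_false => //; apply meet.
  by apply/(@charvec_part_true i.+1) => //; apply meet.
rewrite max_min_weight_le ?andTb //; last exact: part_weight_le2.
rewrite ltnNge; apply/negP => M1; apply: no_meet => i i4.
have part1 d j : (~~ d <= j <= ~~ d + 3)%N -> exists s, charvec s \in part d j.
  move=> j1; apply: min_weight_le1; first exact: part_neq0.
  exact: leq_trans (leq_bigmax_cond _ (part_orbit j1)) M1.
split; first by apply/charvec_part_false => //; apply: part1.
by apply/charvec_part_true => //; apply: part1; case: i i4.
Qed.

Lemma nontrivial_orbits_sw : flip_orbits e :\ [set 0] =
  [set sw_part e (U e) (Bset e 1); sw_part e (U e) (Bset e 2);
       sw_part e (U e) (Bset e 3); sw_part e (U e) (Bset e 4);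
       sw_part e (Ubar e) (Cset e 1); sw_part e (Ubar e) (Cset e 2);
       sw_part e (Ubar e) (Cset e 3); sw_part e (Ubar e) (Cset e 4)].
Proof.
rewrite !sw_part_U // !sw_part_Ubar // nontrivial_orbits /=.
rewrite !orb_of_part //; apply/setP => V; rewrite !inE.
by rewrite -!orbA.
Qed.
End LitOnly.

Theorem theorem6p3 (p : nat) (e : rel 'I_p.+1)
    (n_ge2 : 2 <= p.+1)
    (e_sym : symmetric e) (e_irr : irreflexive e)
    (e_conn : forall x y, connect e x y)
    (e_path : induced_path e)
    (Pi1_even : ~~ odd #|Pi1 e|)
    (Pi1_ge4 : 4 <= #|Pi1 e|) (Pi1_le : #|Pi1 e| <= p.+1 - 3) :
  [/\ flip_orbits e :\ [set 0%R] =
        [set sw_part e (U e) (Bset e 1); sw_part e (U e) (Bset e 2);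
             sw_part e (U e) (Bset e 3); sw_part e (U e) (Bset e 4);
             sw_part e (Ubar e) (Cset e 1); sw_part e (Ubar e) (Cset e 2);
             sw_part e (Ubar e) (Cset e 3); sw_part e (Ubar e) (Cset e 4)],
      #|flip_orbits e| = (if odd p.+1 then 4 else 6)
    & let all_meet := forall i, 1 <= i <= 4 ->
        (exists j, Bset e i j /\ Iset e j) /\
        (exists j, Cset e i j /\ Jset e j) in
      (all_meet -> max_min_weight e = 1) /\
      (~ all_meet -> max_min_weight e = 2)].
Proof.
(* The bounds on [#|Pi1 e|] force n to be at least 7. *)
have p_gt1 : 1 < p by lia.
have cardQ := card_Pi1 e_irr e_path p_gt1.
rewrite cardQ in Pi1_even Pi1_ge4 Pi1_le.
have q_le : #|Pi1_idx e| + 3 <= p.+1 by move: Pi1_le; lia.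
split.
- exact: (nontrivial_orbits_sw e_irr e_sym e_path p_gt1 Pi1_even erefl).
- exact: (card_orbits e_irr e_sym e_path p_gt1 Pi1_even erefl).
- exact: (max_min_weight_cases e_irr e_sym e_path p_gt1 Pi1_even erefl).
Qed.
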